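(* Let $n\ge 2$ and $m\ge 1$, and let $A_n^m$ be the Hamming graph. The orthogonal projection $P_{\rm orth}$ is the unique $\Gamma(n,m)$-invariant projection of the edge space of $A_n^m$ onto its cycle space $Z(A_n^m)$.
   Context: $A_n=\{0,\dots,n-1\}$, and the Hamming graph $A_n^m$ is the graph with vertex set $A_n^m$ in which two vertices are adjacent if and only if they differ in exactly one coordinate. $\Gamma(n,m)$ is its group of graph automorphisms. For a finite graph $G=(V,E)$ with a fixed arbitrary orientation of edges (tail $e^-$, head $e^+$), the cycle space is $Z(G)=\{F\in\mathbb{R}^E:\ \sum_{e^+=v}F(e)=\sum_{e^-=v}F(e)\text{ for all }v\in V\}$. For an edge $uv$, $\overrightarrow{uv}\in\mathbb{R}^E$ is its unit basis vector if it is oriented from $u$ to $v$, and $\overrightarrow{vu}=-\overrightarrow{uv}$. Each graph automorphism $\phi$ induces the linear map $\hat\phi$ of $\mathbb{R}^E$ with $\hat\phi(\overrightarrow{uv})=\overrightarrow{\phi(u)\phi(v)}$. A linear projection $P$ of $\mathbb{R}^E$ onto $Z(A_n^m)$ is $\Gamma(n,m)$-invariant if $P\hat\phi=\hat\phi P$ for every $\phi\in\Gamma(n,m)$. Orthogonality is with respect to the standard inner product on $\mathbb{R}^E$. *)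

(* Defs.v *)
From HB Require Import structures.
From mathcomp Require Import all_boot all_order all_fingroup all_algebra.
From mathcomp Require Import reals.

Set Implicit Arguments.
Unset Strict Implicit.
Unset Printing Implicit Defensive.

Import GRing.Theory.
Local Open Scope ring_scope.

Section Graph.
Variable V : finType.
Implicit Types e o : rel V.

(* A simple graph is its adjacency relation [e].  An orientation [o] keeps
   exactly one of the ordered pairs (u, v), (v, u) for each edge uv, and the
   edge set E is then identified with the set of pairs that are kept. *)
Definition orientation e o : Prop :=
  subrel o e /\ (forall u v, e u v -> o v u = ~~ o u v).

Definition edge o : Type := {p : V * V | o p.1 p.2}.
HB.instance Definition _ o := Finite.copy (edge o) {p : V * V | o p.1 p.2}.

Definition tail o (a : edge o) : V := (val a).1.
Definition head o (a : edge o) : V := (val a).2.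

Definition graph_aut e : {set {perm V}} :=
  [set phi : {perm V} | [forall u, forall v, e (phi u) (phi v) == e u v]].

End Graph.

Notation edge_space R o := {ffun edge o -> R^o}.

Section EdgeSpace.
Variables (R : realType) (V : finType) (o : rel V).
Implicit Types (F G : edge_space R o) (P : 'End(edge_space R o)).

Definition dot F G : R := \sum_a F a * G a.

Definition cycle_space : {pred edge_space R o} :=
  [pred F : edge_space R o |
    [forall v : V, \sum_(a | head a == v) F a == \sum_(a | tail a == v) F a]].

(* At most one of the two terms is nonzero when [o] is an orientation; the
   value is 0 if u and v are not adjacent. *)
Definition arrow (u v : V) : edge_space R o :=
  [ffun a => (val a == (u, v))%:R - (val a == (v, u))%:R].

Definition induced_fun (phi : {perm V}) F : edge_space R o :=
  \sum_a F a *: arrow (phi (tail a)) (phi (head a)).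

Fact induced_fun_linear phi : linear (induced_fun phi).
Proof.
move=> c F G; rewrite /induced_fun scaler_sumr -big_split /=.
by apply: eq_bigr => a _; rewrite !ffunE scalerDl scalerA.
Qed.

HB.instance Definition _ phi :=
  GRing.isLinear.Build R (edge_space R o) (edge_space R o) _ (induced_fun phi)
    (induced_fun_linear phi).

Definition induced (phi : {perm V}) : 'End(edge_space R o) :=
  linfun (induced_fun phi).

Definition projection_onto (Z : {pred edge_space R o}) P : Prop :=
  (P \o P)%VF = P /\ limg P =i Z.

Definition orthogonal_projection_onto (Z : {pred edge_space R o}) P : Prop :=
  projection_onto Z P /\ (forall F G, G \in Z -> dot (F - P F) G = 0).

Definition invariant_under (Gamma : {set {perm V}}) P : Prop :=
  forall phi, phi \in Gamma -> (P \o induced phi)%VF = (induced phi \o P)%VF.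

Lemma arrowC u v : arrow v u = - arrow u v.
Proof. by apply/ffunP => a; rewrite !ffunE opprB. Qed.

Lemma arrow_edge (e : rel V) (a : edge o) : orientation e o ->
  arrow (tail a) (head a) = [ffun b => (b == a)%:R].
Proof.
case=> oe eo; apply/ffunP => b; rewrite !ffunE /tail /head.
have oa := valP a; have ob := valP b.
rewrite -surjective_pairing -val_eqE.
case: (val b =P ((val a).2, (val a).1)) => [E|_]; last by rewrite subr0.
by move: ob; rewrite E /= (eo _ _ (oe _ _ oa)) oa.
Qed.

(* This determines [induced phi], the vectors [arrow u v] spanning R^E. *)
Lemma induced_arrow (e : rel V) phi u v : orientation e o -> e u v ->
  induced phi (arrow u v) = arrow (phi u) (phi v).
Proof.
move=> oeo; have [oe eo] := oeo.
have H x y : o x y -> induced phi (arrow x y) = arrow (phi x) (phi y).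
  move=> oxy; pose a : edge o := Sub (x, y) oxy.
  rewrite -[arrow x y]/(arrow (tail a) (head a)) (arrow_edge a oeo).
  rewrite lfunE /= /induced_fun (bigD1 a) //= ffunE eqxx scale1r big1 ?addr0 //.
  by move=> b /negPf ba; rewrite ffunE ba scale0r.
move=> euv; case ouv : (o u v); first exact: H.
have ovu : o v u by rewrite (eo _ _ euv) ouv.
by rewrite arrowC linearN /= H // -arrowC.
Qed.

End EdgeSpace.

Arguments cycle_space R {V} o.

Notation hamming_vertex n m := {ffun 'I_m -> 'I_n}.

Definition hamming (n m : nat) : rel (hamming_vertex n m) :=
  fun u v => #|[set i | u i != v i]| == 1%N.
Arguments hamming : clear implicits.

(* Main.v *)
(* If P is an invariant projection onto Z = Z(A_n^m), then P - P_orth commutes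
   with the automorphisms, vanishes on Z and takes values in Z; as the orthogonal
   complement of Z is spanned by the stars of the vertices, it suffices to see
   that P kills each star.  The image of the star of c is a cycle that is fixed
   by the stabiliser of c.  Such a cycle vanishes on an edge uv with u and v at
   the same distance from c, because some automorphism fixing c exchanges u and
   v; and it takes the same value on all edges leading from a given u to
   vertices farther from c, so that the conservation law at u makes these values
   0 by induction on the distance from c to u. *)
Require Import Defs.
From HB Require Import structures.
From mathcomp Require Import all_boot all_order all_fingroup all_algebra.
From mathcomp Require Import reals.

Set Implicit Arguments.
Unset Strict Implicit.
Unset Printing Implicit Defensive.

Import Order.TTheory GRing.Theory Num.Theory.
Local Open Scope ring_scope.

Section InvariantProjections.
Variables (R : realType) (V : finType) (e o : rel V).
Hypothesis eo : orientation e o.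
Implicit Types (F G : edge_space R o) (P : 'End(edge_space R o)).
Implicit Types (u v : V) (phi : {perm V}).

Local Notation arrow := (arrow R o).
Local Notation cycle_space := (cycle_space R o).

(** * Inner product, stars and the cycle space *)

Lemma dotC F G : dot F G = dot G F.
Proof. by apply: eq_bigr => a _; rewrite mulrC. Qed.

Lemma dot_linear G : linear_for *%R (dot (o := o) ^~ G).
Proof.
move=> c F F'; rewrite /dot mulr_sumr -big_split /=; apply: eq_bigr => a _.
by rewrite !ffunE mulrDl mulrA.
Qed.

Lemma dotNl F G : dot (- F) G = - dot F G.
Proof. by rewrite /dot -sumrN; apply: eq_bigr => a _; rewrite ffunE mulNr. Qed.

Lemma dot_sumZl (I : finType) (c : I -> R) (F : I -> edge_space R o) G :
  dot (\sum_i c i *: F i) G = \sum_i c i * dot (F i) G.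
Proof.
rewrite /dot; under [RHS]eq_bigr do rewrite mulr_sumr.
rewrite exchange_big /=; apply: eq_bigr => a _.
rewrite sum_ffunE mulr_suml; apply: eq_bigr => i _.
by rewrite !ffunE mulrA.
Qed.

Lemma dot_suml (I : finType) (F : I -> edge_space R o) G :
  dot (\sum_i F i) G = \sum_i dot (F i) G.
Proof.
under eq_bigr do rewrite -[F _]scale1r.
by rewrite dot_sumZl; apply: eq_bigr => i _; rewrite mul1r.
Qed.

Lemma dot_eq0 F : dot F F = 0 -> F = 0.
Proof.
move=> /eqP; rewrite /dot psumr_eq0 => [/allP F0|a _]; last first.
  by rewrite -expr2 sqr_ge0.
apply/ffunP => a; rewrite ffunE; apply/eqP.
by have := F0 a (mem_index_enum a); rewrite mulf_eq0 orbb.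
Qed.

Lemma arrow_nonadjacent u v : ~~ e u v -> ~~ e v u -> arrow u v = 0.
Proof.
move=> euv evu; apply/ffunP => a; rewrite !ffunE.
have ea : e (val a).1 (val a).2 by apply: eo.1; exact: valP a.
have [E|_] := eqVneq (val a) (u, v); first by rewrite E /= (negPf euv) in ea.
have [E|_] := eqVneq (val a) (v, u); first by rewrite E /= (negPf evu) in ea.
by rewrite subrr.
Qed.

(** Since [arrow v u] is 0 unless uv is an edge, this is the signed star of [v], and pairing with it
    gives the net outflow at [v]. *)
Definition star v : edge_space R o := \sum_u arrow v u.

Lemma starE v a : star v a = (tail a == v)%:R - (Defs.head a == v)%:R.
Proof.
rewrite /star sum_ffunE.
under eq_bigr do rewrite ffunE.
rewrite sumrB; congr (_ - _); rewrite /tail /Defs.head; case: (val a) => x y /=.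
  rewrite (bigD1 y) //= big1 ?addr0 ?xpair_eqE ?eqxx ?andbT // => u /negPf yu.
  by rewrite xpair_eqE [y == u]eq_sym yu andbF.
rewrite (bigD1 x) //= big1 ?addr0 ?xpair_eqE ?eqxx // => u /negPf xu.
by rewrite xpair_eqE [x == u]eq_sym xu.
Qed.

Lemma dot_star F v :
  dot F (star v) = \sum_(a | tail a == v) F a - \sum_(a | Defs.head a == v) F a.
Proof.
rewrite /dot [in RHS]big_mkcond [X in _ - X]big_mkcond -sumrB.
apply: eq_bigr => a _; rewrite starE.
by do 2!case: ifP => _; rewrite ?mulr1n ?mulr0n ?subrr ?subr0 ?sub0r ?mulrN
  ?mulr0 ?mulr1 ?oppr0.
Qed.

Lemma cycle_spaceP F :
  reflect (forall v, dot F (star v) = 0) (F \in cycle_space).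
Proof.
apply: (iffP forallP) => H v.
  by rewrite dot_star (eqP (H v)) subrr.
by apply/eqP/esym/eqP; rewrite -subr_eq0 -dot_star H.
Qed.

Lemma dot_arrow_edge F (a : edge o) :
  dot F (arrow (tail a) (Defs.head a)) = F a.
Proof.
rewrite (arrow_edge _ a eo) /dot (bigD1 a) //= ffunE eqxx mulr1 big1 ?addr0 //.
by move=> b /negPf ba; rewrite ffunE ba mulr0.
Qed.

Lemma dot_arrow x y u v : e x y ->
  dot (arrow x y) (arrow u v) = ((x, y) == (u, v))%:R - ((x, y) == (v, u))%:R.
Proof.
have H x' y' : o x' y' -> dot (arrow x' y') (arrow u v)
    = ((x', y') == (u, v))%:R - ((x', y') == (v, u))%:R.
  by move=> oxy; rewrite dotC (dot_arrow_edge _ (Sub (x', y') oxy)) ffunE.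
move=> exy; case oxy : (o x y); first exact: H.
rewrite arrowC dotNl H ?(eo.2 _ _ exy) ?oxy //.
by rewrite opprB !xpair_eqE [(y == u) && _]andbC [(y == v) && _]andbC.
Qed.

(** * Action of an automorphism on edges and stars *)

Section Automorphism.
Variable phi : {perm V}.
Hypothesis autphi : phi \in graph_aut e.

Lemma graph_autE u v : e (phi u) (phi v) = e u v.
Proof. by move: autphi; rewrite inE => /forallP/(_ u)/forallP/(_ v)/eqP. Qed.

Lemma induced_arrow_aut u v :
  induced R o phi (arrow u v) = arrow (phi u) (phi v).
Proof.
have [euv|euv] := boolP (e u v); first exact: induced_arrow eo euv.
have [evu|evu] := boolP (e v u).
  by rewrite arrowC linearN /= (induced_arrow _ _ eo evu) -arrowC.
by rewrite !arrow_nonadjacent ?graph_autE // linear0.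
Qed.

Lemma induced_star v : induced R o phi (star v) = star (phi v).
Proof.
rewrite /star linear_sum [RHS](reindex_inj (@perm_inj _ phi)) /=.
by apply: eq_bigr => u _; rewrite induced_arrow_aut.
Qed.

(** Pairing with [arrow u v] reads off the signed value on uv. As [phi] is injective, it permutes
    the edges up to sign, so the terms of both sums match. *)
Lemma dot_induced_arrow F u v :
  dot (induced R o phi F) (arrow (phi u) (phi v)) = dot F (arrow u v).
Proof.
rewrite lfunE /= /induced_fun dot_sumZl; apply: eq_bigr => a _; congr (_ * _).
rewrite dot_arrow ?graph_autE; last by apply: eo.1; exact: valP a.
rewrite ffunE !xpair_eqE !(inj_eq perm_inj) -!xpair_eqE /tail /Defs.head.
by rewrite -surjective_pairing.
Qed.

Lemma dot_induced_star F v :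
  dot (induced R o phi F) (star (phi v)) = dot F (star v).
Proof.
rewrite !(dotC _ (star _)) /star !dot_suml (reindex_inj (@perm_inj _ phi)) /=.
by apply: eq_bigr => u _; rewrite !(dotC (arrow _ _)) dot_induced_arrow.
Qed.

End Automorphism.

(* This is d d^*, with d mapping a potential on V to its gradient, so that the
   cycle space is its kernel and the image is the orthogonal complement. *)
Definition cut_fun F : edge_space R o := \sum_v dot F (star v) *: star v.

Fact cut_fun_linear : linear cut_fun.
Proof.
move=> c F G; rewrite /cut_fun scaler_sumr -big_split /=.
by apply: eq_bigr => v _; rewrite dot_linear scalerDl scalerA.
Qed.

HB.instance Definition _ :=
  GRing.isLinear.Build R (edge_space R o) (edge_space R o) _ cut_fun
    cut_fun_linear.

Definition cut_op : 'End(edge_space R o) := linfun cut_fun.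

(** * Kernel and image of [cut_op] *)

Lemma cut_op_selfadjoint F G : dot (cut_op F) G = dot F (cut_op G).
Proof.
rewrite !lfunE /= (dotC F) /cut_fun !dot_sumZl; apply: eq_bigr => v _.
by rewrite mulrC (dotC G) (dotC F).
Qed.

Lemma lker_cut_op F : (F \in lker cut_op) = (F \in cycle_space).
Proof.
rewrite memv_ker; apply/eqP/cycle_spaceP => [LF0 v|F0]; last first.
  by rewrite lfunE /= /cut_fun big1 // => v _; rewrite F0 scale0r.
(* This pairing is the sum of the squares of the [dot F (star v)], so each of them vanishes. *)
have: dot (cut_op F) F = 0.
  by rewrite LF0 /dot big1 // => a _; rewrite ffunE mul0r.
rewrite lfunE /= /cut_fun dot_sumZl => /eqP; rewrite psumr_eq0 => [/allP H|w _].
  have /= := H v (mem_index_enum v).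
  by rewrite (dotC (star v)) mulf_eq0 orbb => /eqP.
by rewrite (dotC (star w)) -expr2 sqr_ge0.
Qed.

Lemma dot_ker_img F G : F \in lker cut_op -> G \in limg cut_op -> dot F G = 0.
Proof.
rewrite memv_ker => /eqP LF0 /memv_imgP[H _ ->].
by rewrite -cut_op_selfadjoint LF0 /dot big1 // => a _; rewrite ffunE mul0r.
Qed.

(** A vector in both spaces is orthogonal to itself. *)
Lemma cap_ker_img : (lker cut_op :&: limg cut_op = 0)%VS.
Proof.
apply/eqP; rewrite -subv0; apply/subvP => F; rewrite memv_cap memv0.
by case/andP => F1 F2; apply/eqP/dot_eq0/dot_ker_img.
Qed.

Lemma add_ker_img : (lker cut_op + limg cut_op = fullv)%VS.
Proof.
apply/eqP; rewrite eqEdim subvf /= dimv_disjoint_sum ?cap_ker_img //.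
(* Rank-nullity: the two dimensions add up to that of the whole space. *)
by rewrite -[X in (X <= _)%N](limg_ker_dim cut_op fullv) capfv.
Qed.

(** An automorphism permutes the stars and preserves the pairings with them, so it only reindexes
    the sum. *)
Lemma cut_op_induced phi F : phi \in graph_aut e ->
  cut_op (induced R o phi F) = induced R o phi (cut_op F).
Proof.
move=> autphi; rewrite ![cut_op _]lfunE /= /cut_fun linear_sum.
rewrite (reindex_inj (@perm_inj _ phi)) /=; apply: eq_bigr => v _.
by rewrite linearZ /= induced_star // dot_induced_star.
Qed.

(** * The orthogonal projection: existence, invariance, criterion for uniqueness *)

Definition cycle_proj : 'End(edge_space R o) :=
  daddv_pi (lker cut_op) (limg cut_op).

Lemma cycle_proj_cycle F : F \in cycle_space -> cycle_proj F = F.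
Proof. by rewrite -lker_cut_op => FZ; rewrite daddv_pi_id ?cap_ker_img. Qed.

Lemma cycle_proj_img F : F \in limg cut_op -> cycle_proj F = 0.
Proof.
move=> FB; have := daddv_pi_add cap_ker_img (w := F).
rewrite add_ker_img memvf => /(_ isT).
(* [F] is its own component in the image, so its component in the kernel is 0. *)
by rewrite [X in _ + X]daddv_pi_id ?[(limg _ :&: _)%VS]capvC ?cap_ker_img //;
  move/eqP; rewrite -subr_eq0 addrK => /eqP.
Qed.

Lemma cycle_proj_in F : cycle_proj F \in cycle_space.
Proof. by rewrite -lker_cut_op memv_pi. Qed.

Lemma sub_cycle_proj_in F : F - cycle_proj F \in limg cut_op.
Proof.
have FA : F \in (lker cut_op + limg cut_op)%VS by rewrite add_ker_img memvf.
by rewrite -{1}(daddv_pi_add cap_ker_img FA) addrAC subrr add0r memv_pi.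
Qed.

Lemma cycle_proj_projection : orthogonal_projection_onto cycle_space cycle_proj.
Proof.
split; last first.
  move=> F G; rewrite -lker_cut_op => GZ; rewrite dotC.
  exact: dot_ker_img GZ (sub_cycle_proj_in F).
split.
  by apply/lfunP => F; rewrite lfunE /= cycle_proj_cycle ?cycle_proj_in.
move=> F; apply/memv_imgP/idP => [[G _ ->]|FZ]; first exact: cycle_proj_in.
by exists F; rewrite ?memvf ?cycle_proj_cycle.
Qed.

(** Automorphisms commute with [cut_op], hence preserve both its kernel and its image. *)
Lemma cycle_proj_invariant : invariant_under (graph_aut e) cycle_proj.
Proof.
move=> phi autphi; apply/lfunP => F; rewrite !lfunE /=.
have /memv_imgP[G _ FG] := sub_cycle_proj_in F.
rewrite -[F in LHS](subrK (cycle_proj F)) FG !linearD /= cycle_proj_img;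
  last first.
  by rewrite -cut_op_induced // memv_img ?memvf.
rewrite add0r; apply: cycle_proj_cycle; have := cycle_proj_in F.
rewrite -!lker_cut_op !memv_ker cut_op_induced // => /eqP ->.
by rewrite linear0.
Qed.

(** The first premise applies to [P (star c)], so [P] kills every star and with them the image of
    [cut_op]; on cycles [P] is the identity. *)
Lemma cycle_proj_unique P :
    (forall c F, F \in cycle_space ->
       (forall phi, phi \in graph_aut e -> phi c = c ->
          induced R o phi F = F) ->
       F = 0) ->
  projection_onto cycle_space P -> invariant_under (graph_aut e) P ->
  cycle_proj = P.
Proof.
move=> stab_cycle0 [PP imP] invP.
have Pin F : P F \in cycle_space by rewrite -imP memv_img ?memvf.
have Pid F : F \in cycle_space -> P F = F.
  by rewrite -imP => /memv_imgP[G _ ->]; rewrite -[LHS]comp_lfunE PP.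
have Pstar c : P (star c) = 0.
  apply: (stab_cycle0 c) => // phi autphi phic.
  by rewrite -[LHS]comp_lfunE -invP // comp_lfunE /= induced_star // phic.
apply/lfunP => F; rewrite -[F in RHS](subrK (cycle_proj F)) linearD /=.
rewrite [P (cycle_proj F)]Pid ?cycle_proj_in //.
case/memv_imgP: (sub_cycle_proj_in F) => G _ ->.
rewrite [cut_op G]lfunE /= /cut_fun linear_sum big1 ?add0r // => v _.
by rewrite linearZ /= Pstar scaler0.
Qed.

End InvariantProjections.

(** * Automorphisms of the Hamming graph *)

Section Hamming.
Variables n m : nat.
Local Notation vertex := (hamming_vertex n m).
Implicit Types (u v w c : vertex) (i j k : 'I_m).

Lemma hammingP u v :
  reflect (exists2 i, u i != v i & forall k, k != i -> u k = v k)
          (hamming n m u v).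
Proof.
apply: (iffP (cards1P (A := [set i | u i != v i])))
  => [[i /setP E]|[i ui H]]; exists i.
- by have := E i; rewrite !inE eqxx.
- by move=> k /negPf ki; have := E k; rewrite !inE ki => /negbFE/eqP.
by apply/setP => k; rewrite !inE; have [->//|/H ->] := eqVneq k i; rewrite eqxx.
Qed.

Lemma hamming_sym : symmetric (hamming n m).
Proof.
move=> u v; congr (#|pred_of_set _| == _).
by apply/setP => i; rewrite !inE eq_sym.
Qed.

(** The action of an element of the wreath product of the symmetric groups on symbols and on
    coordinates. *)
Definition coord_map (p : {perm 'I_m}) (s : 'I_m -> {perm 'I_n}) w : vertex :=
  [ffun k => s k (w (p k))].

Lemma coord_map_inj p s : injective (coord_map p s).
Proof.
move=> u v /ffunP E; apply/ffunP => k; have := E (p^-1 k)%g.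
by rewrite !ffunE permKV => /perm_inj.
Qed.

Lemma coord_map_aut p s : perm (@coord_map_inj p s) \in graph_aut (hamming n m).
Proof.
rewrite inE; apply/forallP => u; apply/forallP => v; apply/eqP; rewrite !permE.
(* The images differ exactly on the preimage under [p] of the set where [u] and [v] differ. *)
rewrite /hamming -[in RHS](card_preimset _ (@perm_inj _ p)).
congr (#|pred_of_set _| == _); apply/setP => k.
by rewrite !inE !ffunE (inj_eq perm_inj).
Qed.

(** * Flows fixed by the stabiliser of [c] *)

Section Flow.
(** [f u v] stands for the signed value of a cycle on the edge from [u] to [v], which frees the
    argument from the chosen orientation. *)
Variables (R : realType) (c : vertex) (f : vertex -> vertex -> R).
Hypothesis fC : forall u v, f v u = - f u v.
Hypothesis f0 : forall u v, ~~ hamming n m u v -> f u v = 0.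
Hypothesis fsum : forall u, \sum_v f u v = 0.
Hypothesis finv : forall phi : {perm vertex}, phi \in graph_aut (hamming n m) ->
  phi c = c -> forall u v, f (phi u) (phi v) = f u v.

Lemma finv_coord p s : coord_map p s c = c ->
  forall u v, f (coord_map p s u) (coord_map p s v) = f u v.
Proof.
move=> sc u v; have /= := finv (coord_map_aut p s).
by rewrite !permE => /(_ sc u v); rewrite !permE.
Qed.

(** Transposing the symbols [u i] and [v i] in coordinate [i] fixes [c] and exchanges [u] and [v],
    so [f u v = f v u = - f u v]. *)
Lemma flow_same_level u v i : u i != c i -> v i != c i ->
  (forall k, k != i -> u k = v k) -> f u v = 0.
Proof.
move=> ui vi uv.
pose s k := if k == i then tperm (u i) (v i) else 1%g.
have su : coord_map 1 s u = v.
  apply/ffunP => k; rewrite ffunE perm1 /s.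
  by case: eqVneq => [->|/uv ->]; rewrite ?tpermL ?perm1.
have sv : coord_map 1 s v = u.
  apply/ffunP => k; rewrite ffunE perm1 /s.
  by case: eqVneq => [->|/uv ->]; rewrite ?tpermR ?perm1.
have sc : coord_map 1 s c = c.
  apply/ffunP => k; rewrite ffunE perm1 /s.
  by case: eqVneq => [->|_]; rewrite ?perm1 ?tpermD.
have := finv_coord sc u v; rewrite su sv fC => /eqP.
by rewrite eq_sym -addr_eq0 -mulr2n mulrn_eq0 /= => /eqP.
Qed.

(* The stabiliser of c and u acts transitively on the neighbours of u that are
   farther from c. *)
Lemma flow_up_eq u v w i j :
  u i = c i -> v i != c i -> (forall k, k != i -> u k = v k) ->
  u j = c j -> w j != c j -> (forall k, k != j -> u k = w k) -> f u v = f u w.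
Proof.
move=> ui vi uv uj wj uw.
(* Coordinates [i] and [j] are exchanged, [t] matches the symbols of [c] there, and the extra
   transposition at [j] sends [t (v i)] to [w j] while fixing [c j]. Testing [k == j] first also
   covers [i = j]. *)
pose t := tperm (c i) (c j).
pose s k := if k == j then (t * tperm (t (v i)) (w j))%g
            else if k == i then t else 1%g.
have tvi : t (v i) != c j.
  by rewrite -[X in _ != X](tpermL (c i) (c j)) (inj_eq perm_inj).
have sj : s j (c i) = c j by rewrite /s eqxx permM tpermL tpermD.
have fixed (x : vertex) : x i = c i -> x j = c j ->
    coord_map (tperm i j) s x = x.
  move=> xi xj; apply/ffunP => k; rewrite ffunE.
  have [->|kj] := eqVneq k j; first by rewrite tpermR xi sj.
  rewrite /s (negPf kj); have [->|ki] := eqVneq k i.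
    by rewrite tpermL xj tpermR.
  by rewrite perm1 tpermD // eq_sym.
(* The map fixes [c] and [u]; it remains to see that it sends [v] to [w]. *)
rewrite -(finv_coord (fixed c _ _)) // fixed //; congr (f u _).
apply/ffunP => k; rewrite ffunE.
have [->|kj] := eqVneq k j; first by rewrite tpermR /s eqxx permM tpermL.
rewrite -uw // /s (negPf kj); have [ki|ki] := eqVneq k i.
  by rewrite ki tpermL -uv ?uj ?tpermR ?ui // eq_sym -ki.
by rewrite perm1 tpermD 1?eq_sym // uv.
Qed.

Let dist u := #|[set i | u i != c i]|.

Lemma dist_up u v i : u i = c i -> v i != c i ->
  (forall k, k != i -> u k = v k) -> (dist u < dist v)%N.
Proof.
move=> ui vi uv; apply: proper_card; apply/properP; split.
  apply/subsetP => k; rewrite !inE.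
  by have [->|/uv ->//] := eqVneq k i; rewrite ui eqxx.
by exists i; rewrite !inE ?ui ?eqxx.
Qed.

(** Strong induction on the distance from [c] to [u]: of the edges at [u], only those leading
    farther from [c] can carry flow, and they all carry the same. *)
Lemma flow_up u v i : u i = c i -> v i != c i ->
  (forall k, k != i -> u k = v k) -> f u v = 0.
Proof.
have [d] := ubnP (dist u); elim: d => // d IHd in u v i * => /ltnSE du ui vi uv.
pose up w := [exists j, [&& u j == c j, w j != c j
                         & [forall k, (k != j) ==> (u k == w k)]]].
have fE w : f u w = if up w then f u v else 0.
  case: ifPn => [/existsP[j /and3P[/eqP uj wj /forallP uw]]|Nup].
    apply: (flow_up_eq uj wj _ ui vi uv) => k kj.
    by apply/eqP; have := uw k; rewrite kj.
  have [/hammingP[j ujw uw]|/f0 //] := boolP (hamming n m u w).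
  have [uj|uj] := eqVneq (u j) (c j).
    case/negP: Nup; apply/existsP; exists j; rewrite uj eqxx -uj eq_sym ujw /=.
    by apply/forallP => k; apply/implyP => /uw ->.
  have [wj|wj] := eqVneq (w j) (c j); last exact: flow_same_level uj wj uw.
  (* Here [w] is closer to [c], and the reversed edge falls under the induction hypothesis. *)
  have wu k : k != j -> w k = u k by move=> /uw.
  by rewrite fC (IHd w u j) ?oppr0 //; apply: leq_trans (dist_up wj uj wu) du.
have upv : up v.
  apply/existsP; exists i; rewrite ui eqxx vi.
  by apply/forallP => k; apply/implyP => /uv ->.
(* Conservation at [u] reads: [f u v] times the number of farther neighbours is 0. That number is
   positive, as [v] is one of them. *)
have := fsum u; under eq_bigr do rewrite fE.
rewrite -big_mkcond sumr_const => /eqP; rewrite mulrn_eq0 => /orP[|/eqP //].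
by move/eqP/card0_eq/(_ v); rewrite [_ \in _]upv.
Qed.

Lemma flow_eq0 u v : f u v = 0.
Proof.
have [/hammingP[j ujv uv]|/f0 //] := boolP (hamming n m u v).
have vu k : k != j -> v k = u k by move=> /uv.
have [uj|uj] := eqVneq (u j) (c j).
  by apply: (flow_up uj _ uv); rewrite -uj eq_sym.
have [vj|vj] := eqVneq (v j) (c j); last exact: flow_same_level uj vj uv.
by rewrite fC (flow_up vj uj vu) oppr0.
Qed.

End Flow.
End Hamming.

(** * From flows back to cycles, and the conclusion *)

Lemma hamming_stab_cycle0 (R : realType) (n m : nat)
    (o : rel (hamming_vertex n m)) (ho : orientation (hamming n m) o)
    (c : hamming_vertex n m) (F : edge_space R o) :
  F \in cycle_space R o ->
  (forall phi, phi \in graph_aut (hamming n m) -> phi c = c ->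
     induced R o phi F = F) ->
  F = 0.
Proof.
move=> FZ Finv; apply/ffunP => a; rewrite ffunE -(dot_arrow_edge ho).
apply: (@flow_eq0 n m R c (fun u v => dot F (arrow R o u v)))
  => [u v|u v uv|u|phi aphi phic u v].
- by rewrite arrowC dotC dotNl dotC.
- rewrite (arrow_nonadjacent R ho) // 1?hamming_sym // /dot big1 // => b _.
  by rewrite ffunE mulr0.
(* The total flow out of [u] is the pairing of [F] with [star u]. *)
- under eq_bigr do rewrite dotC.
  by rewrite -dot_suml dotC; exact: (cycle_spaceP F FZ u).
by rewrite -{1}(Finv phi) // (dot_induced_arrow ho).
Qed.

Theorem theorem43 (R : realType) (n m : nat) (hn : (2 <= n)%N) (hm : (1 <= m)%N)
    (o : rel (hamming_vertex n m)) (ho : orientation (hamming n m) o) :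
  exists Porth : 'End(edge_space R o),
    orthogonal_projection_onto (cycle_space R o) Porth /\
    unique (fun P : 'End(edge_space R o) =>
              projection_onto (cycle_space R o) P /\
              invariant_under (graph_aut (hamming n m)) P) Porth.
Proof.
exists (cycle_proj R o); split; first exact: (cycle_proj_projection R o).
split=> [|P [projP invP]].
  by split; [have [] := cycle_proj_projection R o
            | exact: (cycle_proj_invariant R ho)].
by apply: (cycle_proj_unique ho) => // c F; exact: hamming_stab_cycle0.
Qed.
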